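(* Let $t\geq 1$ and, for $1\leq i\leq t$, let $R_i$ be a non-commutative ring with $|R_i|=n_i$ finite and $Z(R_i)=\{0\}$. Let $\delta_i$ be the minimum degree of $\Gamma(R_i)$. (i) If $\delta_i$ is odd for all $1\leq i\leq t$, then $$\gamma_s\Big(\Gamma\Big(\prod_{i=1}^{t}R_i\Big)\Big)\leq \prod_{i=1}^{t}n_i-\prod_{i=1}^t(\delta_i+2)+2.$$ (ii) Otherwise, $$\gamma_s\Big(\Gamma\Big(\prod_{i=1}^{t}R_i\Big)\Big)\leq \prod_{i=1}^{t}n_i-\prod_{i=1}^t(\delta_i+2)+1.$$
   Context: Rings are associative and are not required to have a multiplicative identity. $Z(R)$ is the center of $R$. For a non-commutative ring $R$, the commuting graph $\Gamma(R)$ is the simple graph with vertex set $R\setminus Z(R)$ in which two vertices $x,y$ are adjacent if and only if $x\neq y$ and $xy=yx$. $\prod_{i=1}^t R_i$ is the direct product ring with componentwise operations. For a vertex $v$ of a graph $G$, $N[v]$ is the closed neighbourhood of $v$ ($v$ together with its neighbours). A function $f:V(G)\to\{-1,1\}$ is a signed dominating function if $f[v]:=\sum_{u\in N[v]}f(u)\geq 1$ for every $v\in V(G)$; its weight is $\sum_{x\in V(G)}f(x)$, and the signed domination number $\gamma_s(G)$ is the minimum weight of a signed dominating function of $G$. *)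

(* Defs.v *)
From HB Require Import structures.
From mathcomp Require Import all_boot all_order all_algebra.

Set Implicit Arguments.
Unset Strict Implicit.
Unset Printing Implicit Defensive.

Import Order.TTheory GRing.Theory Num.Theory.
Local Open Scope ring_scope.

(* Associative rings without a multiplicative identity. The unital rings of
   ssralg do not fit: a nontrivial one has 1 in its center, so none of them is
   non-commutative with zero center. *)
HB.mixin Record Zmodule_isNuRing R of GRing.Zmodule R := {
  numul : R -> R -> R;
  numulA : associative numul;
  numulDl : left_distributive numul +%R;
  numulDr : right_distributive numul +%R
}.

#[short(type="nuRingType")]
HB.structure Definition NuRing := {R of Zmodule_isNuRing R & GRing.Zmodule R}.

#[short(type="finNuRingType")]
HB.structure Definition FinNuRing := {R of NuRing R & Finite R}.

Notation "x ** y" := (numul x y) (at level 40, left associativity) : ring_scope.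

Section DirectProduct.
Variables (I : finType) (R : I -> finNuRingType).

Definition direct_product : Type := {dffun forall i, R i}.

HB.instance Definition _ := Finite.on direct_product.

Implicit Types x y z : direct_product.

Definition dp_zero : direct_product := [ffun i => 0 : R i].
Definition dp_opp x : direct_product := [ffun i => - x i].
Definition dp_add x y : direct_product := [ffun i => x i + y i].
Definition dp_mul x y : direct_product := [ffun i => x i ** y i].

Lemma dp_addA : associative dp_add.
Proof. by move=> x y z; apply/ffunP=> i; rewrite !ffunE addrA. Qed.
Lemma dp_addC : commutative dp_add.
Proof. by move=> x y; apply/ffunP=> i; rewrite !ffunE addrC. Qed.
Lemma dp_add0 : left_id dp_zero dp_add.
Proof. by move=> x; apply/ffunP=> i; rewrite !ffunE add0r. Qed.
Lemma dp_addN : left_inverse dp_zero dp_opp dp_add.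
Proof. by move=> x; apply/ffunP=> i; rewrite !ffunE addNr. Qed.

HB.instance Definition _ := GRing.isZmodule.Build direct_product
  dp_addA dp_addC dp_add0 dp_addN.

Lemma dp_mulA : associative dp_mul.
Proof. by move=> x y z; apply/ffunP=> i; rewrite !ffunE numulA. Qed.
Lemma dp_mulDl : left_distributive dp_mul +%R.
Proof. by move=> x y z; apply/ffunP=> i; rewrite !ffunE numulDl. Qed.
Lemma dp_mulDr : right_distributive dp_mul +%R.
Proof. by move=> x y z; apply/ffunP=> i; rewrite !ffunE numulDr. Qed.

HB.instance Definition _ := Zmodule_isNuRing.Build direct_product
  dp_mulA dp_mulDl dp_mulDr.
End DirectProduct.

Definition noncommutative (R : nuRingType) : Prop :=
  exists x y : R, x ** y <> y ** x.

Definition nucenter (R : finNuRingType) : {set R} :=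
  [set z | [forall x, z ** x == x ** z]].

Record sgraph := SGraph {
  vertex :> finType;
  adj : rel vertex;
  adj_sym : symmetric adj;
  adj_irrefl : irreflexive adj
}.

Section Graph.
Variable G : sgraph.
Implicit Types (u v : G).

Definition degree v : nat := #|[set u | adj v u]|.

(* The default value #|G| exceeds every degree, so it is not attained as soon
   as G has a vertex. *)
Definition min_degree : nat := \big[minn/#|G|]_(v : G) degree v.

Definition closed_nbhd v : {set G} := v |: [set u | adj v u].

(* The two-element type {-1, 1}; val : pm1 -> int is the inclusion. *)
Definition pm1 : finType := seq_sub [:: -1; 1 : int].
Definition pm1_one : pm1 := SeqSub (mem_last (-1 : int) [:: 1]).

Implicit Type f : {ffun G -> pm1}.

Definition signed_dominating f : bool :=
  [forall v, 1 <= \sum_(u in closed_nbhd v) (val (f u) : int)].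

Definition weight f : int := \sum_(u : G) val (f u).

Lemma signed_dominating1 : signed_dominating [ffun => pm1_one].
Proof.
apply/forallP=> v; rewrite (bigD1 v) /=; last by rewrite !inE eqxx.
by rewrite ffunE /= lerDl sumr_ge0 // => u _; rewrite ffunE.
Qed.

(* The constant function 1 is signed dominating, so this is the minimum weight
   of a signed dominating function; see signed_domination_numberP. *)
Definition signed_domination_number : int :=
  weight [arg min_(f < [ffun => pm1_one] | signed_dominating f) weight f]%O.

Lemma signed_domination_numberP :
  (exists2 f, signed_dominating f & weight f = signed_domination_number) /\
  (forall f, signed_dominating f -> signed_domination_number <= weight f).
Proof.
rewrite /signed_domination_number.
case: arg_minP => [|f df minf]; first exact: signed_dominating1.
by split=> //; exists f.
Qed.

Lemma min_degreeP v0 :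
  (exists v, degree v = min_degree) /\ (forall v, (min_degree <= degree v)%N).
Proof.
have le_min v : (min_degree <= degree v)%N.
  by rewrite /min_degree -minEnat; apply: (@bigmin_le_cond _ nat).
split=> //; rewrite /min_degree.
have : (exists v, degree v = min_degree) \/ min_degree = #|G|.
  rewrite /min_degree; elim/big_rec: _ => [|v m _ IH]; first by right.
  by rewrite /minn; case: ifP => _; [left; exists v | exact: IH].
case=> // eqG; exfalso; have := le_min v0; rewrite eqG leqNgt => /negP; apply.
rewrite -cardsT; apply: proper_card; rewrite properEneq subsetT andbT.
by apply/eqP=> /setP/(_ v0); rewrite !inE adj_irrefl.
Qed.

End Graph.

Section CommutingGraph.
Variable R : finNuRingType.

Definition commuting_vertex : finType := {x : R | x \notin nucenter R}.

Definition commuting_adj : rel commuting_vertex :=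
  fun x y => (x != y) && (val x ** val y == val y ** val x).

Lemma commuting_adj_sym : symmetric commuting_adj.
Proof. by move=> x y; rewrite /commuting_adj eq_sym [X in _ && X]eq_sym. Qed.

Lemma commuting_adj_irrefl : irreflexive commuting_adj.
Proof. by move=> x; rewrite /commuting_adj eqxx. Qed.

Definition commuting_graph : sgraph :=
  SGraph commuting_adj_sym commuting_adj_irrefl.
End CommutingGraph.

(* Main.v *)
Require Import Defs.
From mathcomp Require Import all_boot all_order all_algebra.
From mathcomp Require Import zify.

Set Implicit Arguments.
Unset Strict Implicit.
Unset Printing Implicit Defensive.

Import Order.TTheory GRing.Theory Num.Theory.
Local Open Scope ring_scope.

(** In any graph with minimum degree d, put -1 on an arbitrary set of
    floor(d/2) vertices and 1 elsewhere.  A closed neighbourhood has at least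
    d+1 vertices, of which at most floor(d/2) carry -1, so its sum is at
    least 1: the domination number is at most |G| - 2 floor(d/2)
    ([signed_domination_number_le]).

    The commuting graph of a ring R with zero center has |R| - 1 vertices, and
    a vertex x has degree |C(x)| - 2, because 0 and x are the only elements of
    the centralizer C(x) which are not neighbours of x.  Centralizers in a
    direct product are products of centralizers, hence every centralizer in the
    product ring has at least m = prod (delta_i + 2) elements and the minimum
    degree is at least m - 2 ([min_degree_direct_product]).  The bound becomes
    |R| - 1 - 2 floor((m - 2)/2), which is |R| - m + 2 or |R| - m + 1 according
    to the parity of m; and m is odd exactly when all the delta_i are. *)

(** * Signed domination and minimum degree *)

Section SignedDomination.
Variable G : sgraph.

Lemma min_degree_le_card : (min_degree G <= #|G|)%N.
Proof.
rewrite /min_degree; elim/big_rec: _ => // v m _ le_m.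
by rewrite geq_min le_m orbT.
Qed.

Lemma min_degree_le (v : G) : (min_degree G <= degree v)%N.
Proof. by case: (min_degreeP v). Qed.

Lemma card_closed_nbhd (v : G) : #|closed_nbhd v| = (degree v).+1.
Proof. by rewrite /closed_nbhd cardsU1 inE adj_irrefl. Qed.

Definition pm1_minus_one : pm1 := SeqSub (mem_head (-1 : int) [:: 1]).

Definition minus_one_on (S : {set G}) : {ffun G -> pm1} :=
  [ffun u => if u \in S then pm1_minus_one else pm1_one].

Lemma sum_minus_one_on (S A : {set G}) :
  \sum_(u in A) (val (minus_one_on S u) : int)
    = #|A|%:Z - (#|A :&: S|.*2)%:Z.
Proof.
rewrite (big_setID S) /=.
rewrite (eq_bigr (fun=> -1)) => [|u]; last first.
  by rewrite inE ffunE => /andP[_ ->].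
rewrite [X in _ + X](eq_bigr (fun=> 1)) => [|u]; last first.
  by rewrite inE ffunE => /andP[/negPf->].
rewrite !sumr_const -(cardsID S A); lia.
Qed.

(** The positions of the values -1 do not matter: even if all of them fall in
    one closed neighbourhood, the values 1 remain in the majority there. *)
Lemma signed_domination_number_le :
  signed_domination_number G <= #|G|%:Z - ((min_degree G)./2.*2)%:Z.
Proof.
have [_ gamma_min] := signed_domination_numberP G.
have /card_geqP[s [s_uniq s_size _]] : ((min_degree G)./2 <= #|G|)%N.
  by have := min_degree_le_card; lia.
have cardS : #|[set:: s]| = (min_degree G)./2.
  by rewrite cardsE (card_uniqP s_uniq).
apply: (le_trans (gamma_min (minus_one_on [set:: s]) _)).
  apply/forallP => v; rewrite sum_minus_one_on card_closed_nbhd.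
  have := min_degree_le v.
  have := subset_leq_card (subsetIr (closed_nbhd v) [set:: s]).
  by rewrite cardS; lia.
rewrite /weight -(eq_bigl _ _ (in_setT (T := G))) sum_minus_one_on.
by rewrite setTI cardsT cardS.
Qed.

End SignedDomination.

(** * Centralizers and the commuting graph *)

Section Centralizer.
Variable R : finNuRingType.

Definition centralizer (x : R) : {set R} := [set y | x ** y == y ** x].

Lemma nucenterP (z : R) :
  reflect (forall x, z ** x = x ** z) (z \in nucenter R).
Proof.
rewrite inE; apply: (iffP forallP) => cz x; first exact/eqP.
exact/eqP.
Qed.

Lemma numul0r (x : R) : 0 ** x = 0.
Proof. by apply: (addIr (0 ** x)); rewrite -numulDl !add0r. Qed.

Lemma numulr0 (x : R) : x ** 0 = 0.
Proof. by apply: (addIr (x ** 0)); rewrite -numulDr !add0r. Qed.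

Lemma card_commuting_graph : #|commuting_graph R| = (#|R| - #|nucenter R|)%N.
Proof. by rewrite card_sig -(cardC (mem (nucenter R))) addKn. Qed.

(** The part of the centralizer of x outside the neighbourhood of x consists of
    the center and of x itself. *)
Lemma card_centralizer (v : commuting_graph R) :
  #|centralizer (val v)| = (degree v + #|nucenter R| + 1)%N.
Proof.
set x := val v.
have xNZ : x \notin nucenter R := valP v.
have sub : nucenter R \subset centralizer x.
  by apply/subsetP => z /nucenterP cz; rewrite inE cz.
rewrite -(cardsID (nucenter R) (centralizer x)) (setIidPr sub).
have xC : x \in centralizer x :\: nucenter R by rewrite in_setD xNZ inE eqxx.
rewrite (cardsD1 x (_ :\: _)) xC.
suff -> : (centralizer x :\: nucenter R) :\ x = val @: [set u | adj v u].
  rewrite card_imset; last exact: val_inj.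
  by rewrite /= add1n addnS [X in X.+1]addnC addn1.
apply/setP => y; rewrite !inE; apply/idP/imsetP => [/and3P[yx yNZ xy]|[u]].
  have yNZ' : y \notin nucenter R by rewrite inE.
  exists (Sub y yNZ') => //; rewrite inE /= /commuting_adj /= xy andbT.
  by rewrite eq_sym -val_eqE.
rewrite inE => /andP[vu vuC] ->; rewrite vuC andbT.
have := valP u; rewrite inE => ->; rewrite andbT.
by rewrite eq_sym val_eqE.
Qed.

Hypothesis R_center : nucenter R = [set 0].

Lemma nucenter0_vertex (x : R) : x != 0 -> x \notin nucenter R.
Proof. by rewrite R_center inE. Qed.

Lemma card_centralizer_center0 (v : commuting_graph R) :
  #|centralizer (val v)| = (degree v + 2)%N.
Proof.
have card_center : #|nucenter R| = 1%N by rewrite R_center cards1.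
by rewrite card_centralizer card_center -addnA.
Qed.

(** For x = 0 the centralizer is the whole ring, which contains the
    centralizer of a vertex. *)
Lemma min_degree_le_centralizer (x : R) :
  noncommutative R ->
  (min_degree (commuting_graph R) + 2 <= #|centralizer x|)%N.
Proof.
have vertex_le y : y != 0 ->
    (min_degree (commuting_graph R) + 2 <= #|centralizer y|)%N.
  move=> /nucenter0_vertex yNZ; pose v : commuting_graph R := Sub y yNZ.
  rewrite -[y]/(val v) card_centralizer_center0 leq_add2r.
  exact: min_degree_le.
have [->|/vertex_le//] := eqVneq x 0.
move=> [y [z yz]]; apply: leq_trans (vertex_le y _) _.
  by apply/eqP => y0; apply: yz; rewrite y0 numul0r numulr0.
by apply/subset_leq_card/subsetP => u _; rewrite inE numul0r numulr0.
Qed.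

End Centralizer.

(** * Direct products *)

Section Product.
Variables (I : finType) (R : I -> finNuRingType).

Lemma centralizer_direct_product (x : direct_product R) :
  centralizer x =i family (fun i => mem (centralizer (x i))).
Proof.
move=> y; rewrite inE; apply/eqP/familyP => [xy i | xy].
  by move/ffunP: xy => /(_ i); rewrite !ffunE inE => ->.
by apply/ffunP => i; rewrite !ffunE; move: (xy i); rewrite inE => /eqP.
Qed.

Lemma card_centralizer_direct_product (x : direct_product R) :
  #|centralizer x| = (\prod_i #|centralizer (x i)|)%N.
Proof.
rewrite (eq_card (centralizer_direct_product x)) card_family.
by rewrite foldrE big_map big_enum.
Qed.

(** Commuting with these elements tests a single component, so a central
    element has central components. *)
Definition dp_single (i : I) (a : R i) : direct_product R :=
  [ffun j => dfwith (fun j => 0 : R j) a j].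

Lemma dp_singleE (i : I) (a : R i) : dp_single a i = a.
Proof. by rewrite ffunE dfwith_in. Qed.

Hypothesis R_center : forall i, nucenter (R i) = [set 0].

Lemma nucenter_direct_product : nucenter (direct_product R) = [set 0].
Proof.
apply/setP => z; rewrite in_set1; apply/nucenterP/eqP => [cz|-> x]; last first.
  by rewrite numul0r numulr0.
apply/ffunP => i; rewrite ffunE.
suff: z i \in nucenter (R i) by rewrite R_center inE => /eqP.
apply/nucenterP => a; have /ffunP/(_ i) := cz (dp_single a).
by rewrite !ffunE dfwith_in.
Qed.

Hypothesis R_noncomm : forall i, noncommutative (R i).

(** The index i0 provides a vertex of the commuting graph, so that the minimum
    degree is attained at some v.  The components of v may be zero, hence the
    need for a bound on the centralizers of all elements of each factor. *)
Lemma min_degree_direct_product (i0 : I) :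
  (\prod_i (min_degree (commuting_graph (R i)) + 2)
     <= min_degree (commuting_graph (direct_product R)) + 2)%N.
Proof.
have [a [b ab]] := R_noncomm i0.
have xn0 : dp_single a != 0.
  apply/eqP => /ffunP/(_ i0); rewrite dp_singleE ffunE => a0.
  by apply: ab; rewrite a0 numul0r numulr0.
have xNZ := nucenter0_vertex nucenter_direct_product xn0.
pose v0 : commuting_graph (direct_product R) := Sub (dp_single a) xNZ.
have [[v <-] _] := min_degreeP v0.
rewrite -(card_centralizer_center0 nucenter_direct_product).
rewrite card_centralizer_direct_product; apply: leq_prod => i _.
exact: min_degree_le_centralizer.
Qed.

End Product.

Lemma odd_prod (I : finType) (F : I -> nat) :
  odd (\prod_i F i) = [forall i, odd (F i)].
Proof.
rewrite (big_morph odd oddM (erefl : odd 1 = true)) big_andE.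
by apply: eq_forallb.
Qed.

Theorem theoremE (t : nat) (R : 'I_t -> finNuRingType)
    (t_ge1 : (1 <= t)%N)
    (R_noncomm : forall i : 'I_t, noncommutative (R i))
    (R_center : forall i : 'I_t, nucenter (R i) = [set 0]) :
  let n (i : 'I_t) := #|R i| in
  let delta (i : 'I_t) := min_degree (commuting_graph (R i)) in
  let gamma := signed_domination_number (commuting_graph (direct_product R)) in
  ((forall i : 'I_t, odd (delta i)) ->
     gamma <= (\prod_(i < t) n i)%N%:Z
              - (\prod_(i < t) (delta i + 2))%N%:Z + 2)
  /\
  (~ (forall i : 'I_t, odd (delta i)) ->
     gamma <= (\prod_(i < t) n i)%N%:Z
              - (\prod_(i < t) (delta i + 2))%N%:Z + 1).
Proof.
move=> n delta gamma.
have mindeg := min_degree_direct_product R_center R_noncomm (Ordinal t_ge1).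
have gamma_le : gamma <= _ := signed_domination_number_le _.
have card_dp : #|{: direct_product R}| = (\prod_i n i)%N.
  by rewrite card_dep_ffun foldrE big_map big_enum.
have n_gt0 : (0 < \prod_i n i)%N.
  by rewrite -card_dp; apply/card_gt0P; exists 0.
rewrite card_commuting_graph nucenter_direct_product // cards1 card_dp
  in gamma_le.
have odd_m : odd (\prod_i (delta i + 2)) = [forall i, odd (delta i)].
  by rewrite odd_prod; apply: eq_forallb => i; rewrite oddD addbF.
move: mindeg gamma_le n_gt0 odd_m.
set m := (\prod_i (delta i + 2))%N; set N := (\prod_i n i)%N.
set d := min_degree _.
move=> mindeg gamma_le n_gt0 odd_m.
split=> [_|/forallP]; first by lia.
by rewrite -odd_m; lia.
Qed.
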